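(* Let $f:\mathbb{R}^m\to\mathbb{R}$ be $C^3$, satisfying the Lojasiewicz gradient inequality at each of its critical points, and let $\{x_k\}$ be a sequence constructed by Backtracking New Q-Newton's method (BNQN) with $0<\tau\le1$. For each $k$ with $\nabla f(x_k)\ne0$ let $e_{1,k},\dots,e_{m,k}$ be an orthonormal basis of eigenvectors of $A_k$, and let $\Lambda_k=\{i:\langle\nabla f(x_k),e_{i,k}\rangle\neq0\}$. Assume that whenever a subsequence $\{x_{k_n}\}$ converges, $$\liminf_{n\to\infty}\frac{\min_{i\in\Lambda_{k_n}}\|A_{k_n}e_{i,k_n}\|}{\max_{i\in\Lambda_{k_n}}\|A_{k_n}e_{i,k_n}\|}>0.$$ If $\tau=1$, assume moreover that $\nabla f$ satisfies the Lojasiewicz gradient inequality. Then either $\lim_{k\to\infty}\|x_k\|=\infty$ or $\{x_k\}$ converges to a critical point of $f$.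
   Context: BNQN: fix $m+1$ distinct reals $\delta_0,\dots,\delta_m$, $\tau>0$, $0<\gamma_0<1$, $\kappa=\frac12\min_{i\neq j}|\delta_i-\delta_j|$; $\mathrm{minsp}(A)$ is the minimum absolute value of eigenvalues of a symmetric matrix $A$, and $pr_{A,\pm}$ the orthogonal projections onto the spans of eigenvectors with positive/negative eigenvalues. Given $x_k$: if $\nabla f(x_k)=0$ set $x_{k+1}=x_k$; otherwise let $j$ be the smallest index with $\mathrm{minsp}(\nabla^2 f(x_k)+\delta_j\|\nabla f(x_k)\|^\tau I)\ge\kappa\|\nabla f(x_k)\|^\tau$, $A_k=\nabla^2 f(x_k)+\delta_j\|\nabla f(x_k)\|^\tau I$, $v_k=A_k^{-1}\nabla f(x_k)$, $w_k=pr_{A_k,+}v_k-pr_{A_k,-}v_k$, $\widehat{w_k}=w_k/\max\{1,\|w_k\|\}$, $\gamma_k$ the largest $\gamma\in\{\gamma_03^{-n}:n\ge0\}$ with $f(x_k-\gamma\widehat{w_k})-f(x_k)\le-\gamma\langle\widehat{w_k},\nabla f(x_k)\rangle/3$, and $x_{k+1}=x_k-\gamma_k\widehat{w_k}$. A $C^1$ function $g$ satisfies the Lojasiewicz gradient inequality at $x^*$ if there exist a neighbourhood $U$ of $x^*$, $0<\mu<1$, $C>0$ with $|g(x)-g(x^* )|^\mu\le C\|\nabla g(x)\|$ for all $x\in U$. ''$\nabla f$ satisfies the Lojasiewicz gradient inequality'' means $F(x,y)=\langle\nabla f(x),y\rangle$ on $\mathbb{R}^{2m}$ satisfies it at every point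 of $\mathbb{R}^{2m}$. *)

(* Defs.v *)
From HB Require Import structures.
From mathcomp Require Import all_boot all_order all_algebra.
From mathcomp Require Import all_classical all_reals all_analysis.
Set Implicit Arguments. Unset Strict Implicit. Unset Printing Implicit Defensive.
Import Order.TTheory GRing.Theory Num.Theory.
Import numFieldNormedType.Exports.
Local Open Scope classical_set_scope.
Local Open Scope ring_scope.

Section BNQN.
Variable R : realType.

Definition dot m (u v : 'cV[R]_m) : R := \sum_(i < m) u i ord0 * v i ord0.
Definition enorm m (u : 'cV[R]_m) : R := Num.sqrt (dot u u).

Definition ev m (i : 'I_m) : 'cV[R]_m := delta_mx i ord0.

Definition partial m (i : 'I_m) (f : 'cV[R]_m -> R) : 'cV[R]_m -> R :=
  fun x => derive f x (ev i).
Definition grad m (f : 'cV[R]_m -> R) (x : 'cV[R]_m) : 'cV[R]_m :=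
  \col_i partial i f x.
Definition hess m (f : 'cV[R]_m -> R) (x : 'cV[R]_m) : 'M[R]_m :=
  \matrix_(i, j) partial j (partial i f) x.

Fixpoint Ck m (k : nat) (f : 'cV[R]_m -> R) : Prop :=
  continuous f /\
  match k with
  | 0 => True
  | k'.+1 => forall i : 'I_m, (forall x, derivable f x (ev i)) /\ Ck k' (partial i f)
  end.

Definition loj_at m (g : 'cV[R]_m -> R) (xs : 'cV[R]_m) : Prop :=
  exists U : set 'cV[R]_m, nbhs xs U /\
  exists mu C : R, 0 < mu < 1 /\ 0 < C /\
    forall x, U x -> powR `|g x - g xs| mu <= C * enorm (grad g x).

Definition gradF m (f : 'cV[R]_m -> R) (z : 'cV[R]_(m + m)) : R :=
  dot (grad f (usubmx z)) (dsubmx z).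

Definition is_eigval m (A : 'M[R]_m) (l : R) : Prop :=
  exists u : 'cV[R]_m, u != 0 /\ A *m u = l *: u.
Definition minsp m (A : 'M[R]_m) : R :=
  inf [set `|l| | l in is_eigval A].

Definition in_span m (S : set 'cV[R]_m) (u : 'cV[R]_m) : Prop :=
  exists n (c : 'I_n -> R) (s : 'I_n -> 'cV[R]_m),
    (forall j, S (s j)) /\ u = \sum_(j < n) c j *: s j.
Definition orth_proj m (S : set 'cV[R]_m) (v : 'cV[R]_m) : 'cV[R]_m :=
  xget 0 [set p | in_span S p /\ forall u, S u -> dot (v - p) u = 0].
Definition eigvecs_pos m (A : 'M[R]_m) : set 'cV[R]_m :=
  [set u | exists l, 0 < l /\ A *m u = l *: u].
Definition eigvecs_neg m (A : 'M[R]_m) : set 'cV[R]_m :=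
  [set u | exists l, l < 0 /\ A *m u = l *: u].
Definition pr_pos m (A : 'M[R]_m) := orth_proj (eigvecs_pos A).
Definition pr_neg m (A : 'M[R]_m) := orth_proj (eigvecs_neg A).

Variables (m : nat) (delta : 'I_m.+1 -> R) (tau gamma0 : R).
Variable f : 'cV[R]_m -> R.

Definition kappa : R :=
  inf [set `|delta ij.1 - delta ij.2| | ij in
         [set ij : 'I_m.+1 * 'I_m.+1 | ij.1 != ij.2]] / 2.

Definition gpow (x : 'cV[R]_m) : R := powR (enorm (grad f x)) tau.

Definition Ashift (x : 'cV[R]_m) (j : 'I_m.+1) : 'M[R]_m :=
  hess f x + (delta j * gpow x) *: 1%:M.

Definition admissible (x : 'cV[R]_m) (j : 'I_m.+1) : bool :=
  kappa * gpow x <= minsp (Ashift x j).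

Definition jsel (x : 'cV[R]_m) : 'I_m.+1 :=
  xget ord0 [set j | admissible x j /\
                     forall j' : 'I_m.+1, (j' < j)%N -> ~~ admissible x j'].

Definition Amat (x : 'cV[R]_m) : 'M[R]_m := Ashift x (jsel x).
Definition vdir (x : 'cV[R]_m) : 'cV[R]_m := invmx (Amat x) *m grad f x.
Definition wdir (x : 'cV[R]_m) : 'cV[R]_m :=
  pr_pos (Amat x) (vdir x) - pr_neg (Amat x) (vdir x).
Definition what (x : 'cV[R]_m) : 'cV[R]_m :=
  (Num.max 1 (enorm (wdir x)))^-1 *: wdir x.

Definition armijo (x : 'cV[R]_m) (n : nat) : bool :=
  f (x - (gamma0 / 3 ^+ n) *: what x) - f x
    <= - ((gamma0 / 3 ^+ n) * dot (what x) (grad f x)) / 3.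

Definition nsel (x : 'cV[R]_m) : nat :=
  xget 0%N [set n | armijo x n /\ forall n', (n' < n)%N -> ~~ armijo x n'].
Definition gammak (x : 'cV[R]_m) : R := gamma0 / 3 ^+ nsel x.

Definition bnqn_step (x : 'cV[R]_m) : 'cV[R]_m :=
  if grad f x == 0 then x else x - gammak x *: what x.

End BNQN.

(* Main.v *)
Require Import Defs.
From HB Require Import structures.
From mathcomp Require Import all_boot all_order all_algebra.
From mathcomp Require Import all_classical all_reals all_analysis.
From mathcomp Require Import ring lra.
Import Order.TTheory GRing.Theory Num.Theory.
Import numFieldNormedType.Exports.
Local Open Scope classical_set_scope.
Local Open Scope ring_scope.

(** By the eigenvalue-ratio assumption, the search directions make an angle with
    the gradient whose cosine is bounded below near any cluster point [xs] of the
    sequence, so Armijo's rule gives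
      [f (x k) - f (x k.+1) >= c * |x k.+1 - x k| * |grad f (x k)|]
    there.  Were [xs] not critical, the step sizes would be bounded below near
    [xs] and [f] would drop by a fixed amount infinitely often, contradicting
    [f (x k) --> f xs].  At a critical [xs] the Lojasiewicz inequality bounds
    [|x k.+1 - x k|] by the decrease of [(f (x k) - f xs) ^ (1 - mu)], and
    telescoping shows that iterates which come close to [xs] stay there. *)

(** * Euclidean inner product and norm on column vectors *)

Section Euclidean.
Context {R : realType} {m : nat}.
Implicit Types (u v w : 'cV[R]_m) (a : R).

Lemma dotC u v : dot u v = dot v u.
Proof. by apply: eq_bigr => i _; rewrite mulrC. Qed.

Lemma dotDl u v w : dot (u + v) w = dot u w + dot v w.
Proof. by rewrite /dot -big_split; apply: eq_bigr => i _; rewrite mxE mulrDl. Qed.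

Lemma dotZl a u v : dot (a *: u) v = a * dot u v.
Proof. by rewrite /dot mulr_sumr; apply: eq_bigr => i _; rewrite mxE mulrA. Qed.

Lemma dotZr a u v : dot u (a *: v) = a * dot u v.
Proof. by rewrite dotC dotZl dotC. Qed.

Lemma dotNl u v : dot (- u) v = - dot u v.
Proof. by rewrite -scaleN1r dotZl mulN1r. Qed.

Lemma dotDr u v w : dot u (v + w) = dot u v + dot u w.
Proof. by rewrite !(dotC u) dotDl. Qed.

Lemma dotBl u v w : dot (u - v) w = dot u w - dot v w.
Proof. by rewrite dotDl dotNl. Qed.

Lemma dotBr u v w : dot w (u - v) = dot w u - dot w v.
Proof. by rewrite !(dotC w) dotBl. Qed.

Lemma dot0l v : dot 0 v = 0.
Proof. by rewrite -(scale0r 0) dotZl mul0r. Qed.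

Lemma dot_suml n (s : 'I_n -> 'cV[R]_m) v :
  dot (\sum_i s i) v = \sum_i dot (s i) v.
Proof.
by apply: (big_morph (fun u => dot u v)) => [x y|]; rewrite ?dotDl ?dot0l.
Qed.

Lemma dot_ge0 u : 0 <= dot u u.
Proof. by apply: sumr_ge0 => i _; rewrite -expr2 sqr_ge0. Qed.

Lemma dot_eq0 u : dot u u = 0 -> u = 0.
Proof.
move=> /eqP; rewrite psumr_eq0 => [/allP h|i _]; last by rewrite -expr2 sqr_ge0.
apply/matrixP => i j; rewrite ord1 mxE; apply/eqP.
by have := h i (mem_index_enum i); rewrite /= mulf_eq0 orbb.
Qed.

Lemma enorm_ge0 u : 0 <= enorm u.
Proof. exact: sqrtr_ge0. Qed.

Lemma enorm_sqr u : enorm u ^+ 2 = dot u u.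
Proof. by rewrite sqr_sqrtr ?dot_ge0. Qed.

Lemma enorm0 : enorm (0 : 'cV[R]_m) = 0.
Proof. by rewrite /enorm dot0l sqrtr0. Qed.

Lemma enorm_eq0 u : enorm u = 0 -> u = 0.
Proof. by move=> h; apply: dot_eq0; rewrite -enorm_sqr h expr0n. Qed.

Lemma enorm_gt0 u : u != 0 -> 0 < enorm u.
Proof.
by move=> u0; rewrite lt_def enorm_ge0 andbT; apply: contraNneq u0 => /enorm_eq0 ->.
Qed.

Lemma enormZ a u : enorm (a *: u) = `|a| * enorm u.
Proof.
by rewrite /enorm dotZl dotZr mulrA -expr2 sqrtrM ?sqr_ge0// sqrtr_sqr.
Qed.

Lemma enormN u : enorm (- u) = enorm u.
Proof. by rewrite -scaleN1r enormZ normrN1 mul1r. Qed.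

Lemma enormBC u v : enorm (u - v) = enorm (v - u).
Proof. by rewrite -opprB enormN. Qed.

(** Cauchy-Schwarz, by expanding the squared length of [enorm v *: u - enorm u *: v]. *)
Lemma dot_le_enorm u v : dot u v <= enorm u * enorm v.
Proof.
have [->|/enorm_gt0 u0] := eqVneq u 0; first by rewrite dot0l enorm0 mul0r.
have [->|/enorm_gt0 v0] := eqVneq v 0; first by rewrite dotC dot0l enorm0 mulr0.
have := dot_ge0 (enorm v *: u - enorm u *: v).
rewrite dotBl !dotBr !dotZl !dotZr -!enorm_sqr (dotC v u) => h.
have uv0 : 0 < enorm u * enorm v by rewrite mulr_gt0.
rewrite -(ler_pM2l uv0); nra.
Qed.

Lemma enormD u v : enorm (u + v) <= enorm u + enorm v.
Proof.
rewrite -(ler_pXn2r (n := 2)) ?nnegrE ?addr_ge0 ?enorm_ge0//.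
rewrite enorm_sqr dotDl !dotDr (dotC v u) sqrrD !enorm_sqr.
by have := dot_le_enorm u v; lra.
Qed.

Lemma enormB_trans u v w : enorm (u - w) <= enorm (u - v) + enorm (v - w).
Proof. by rewrite (_ : u - w = (u - v) + (v - w)) ?enormD// addrA subrK. Qed.

(** The norm behind neighbourhoods and limits is the largest absolute entry; the comparisons from
    here on carry statements between it and [enorm]. *)
Lemma coord_le_norm u i : `|u i ord0| <= `|u|.
Proof.
rewrite [leRHS]/Num.norm /= mx_normrE.
by apply/bigmax_geP; right => /=; exists (i, ord0).
Qed.

Lemma norm_le_coord u a : 0 <= a -> (forall i, `|u i ord0| <= a) -> `|u| <= a.
Proof.
move=> a0 h; rewrite [leLHS]/Num.norm /= mx_normrE.
by apply: bigmax_le => // -[i j] _ /=; rewrite ord1.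
Qed.

Lemma coord_le_enorm u i : `|u i ord0| <= enorm u.
Proof.
rewrite -sqrtr_sqr ler_sqrt ?dot_ge0// /dot (bigD1 i)//= expr2 lerDl.
by apply: sumr_ge0 => j _; rewrite -expr2 sqr_ge0.
Qed.

Lemma norm_le_enorm u : `|u| <= enorm u.
Proof. by apply: norm_le_coord (enorm_ge0 u) _ => i; exact: coord_le_enorm. Qed.

Lemma enorm_le_sum u : enorm u <= \sum_i `|u i ord0|.
Proof.
have s0 : 0 <= \sum_i `|u i ord0| by apply: sumr_ge0.
rewrite -(ler_pXn2r (n := 2)) ?nnegrE ?enorm_ge0// enorm_sqr expr2 mulr_suml.
apply: ler_sum => i _; rewrite (le_trans (ler_norm _))// normrM ler_wpM2l//.
by rewrite (bigD1 i)//= lerDl sumr_ge0.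
Qed.

Lemma enorm_le_norm u : enorm u <= m%:R * `|u|.
Proof.
apply: le_trans (enorm_le_sum u) _.
rewrite -[X in X%:R]card_ord mulr_natl -sumr_const.
by apply: ler_sum => i _; exact: coord_le_norm.
Qed.

End Euclidean.

(** * Coordinates in an orthonormal eigenbasis *)

Section Eigenbasis.
Context {R : realType} {m : nat}.
Variable (e : 'I_m -> 'cV[R]_m).
Hypothesis on : forall i j, dot (e i) (e j) = (i == j)%:R.
Implicit Types (u v : 'cV[R]_m) (c d : 'I_m -> R).

Lemma dot_basis c i : dot (\sum_j c j *: e j) (e i) = c i.
Proof.
rewrite dot_suml (bigD1 i)//= dotZl on eqxx mulr1 big1 ?addr0// => j ji.
by rewrite dotZl on (negPf ji) mulr0.
Qed.

(** The square matrix [E] with columns [e i] has [E^T] as left inverse, hence as right inverse, so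
    [m] orthonormal vectors are complete. *)
Lemma basis_expansion u : u = \sum_i dot u (e i) *: e i.
Proof.
pose E : 'M[R]_m := \matrix_(i, j) e j i ord0.
have EE : E^T *m E = 1%:M.
  apply/matrixP => i j; rewrite !mxE -on; apply: eq_bigr => k _.
  by rewrite !mxE.
have EE' : E *m E^T = 1%:M by exact: mulmx1C.
rewrite -{1}[u]mul1mx -EE' -mulmxA; apply/matrixP => i j.
rewrite ord1 !mxE summxE; apply: eq_bigr => k _.
rewrite !mxE mulrC; congr (_ * _); rewrite dotC.
by apply: eq_bigr => l _; rewrite !mxE.
Qed.

Lemma dot_basis2 c d :
  dot (\sum_j c j *: e j) (\sum_j d j *: e j) = \sum_j c j * d j.
Proof.
rewrite dotC dot_suml; apply: eq_bigr => i _.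
by rewrite dotZl dotC dot_basis mulrC.
Qed.

Lemma enorm_basis i : enorm (e i) = 1.
Proof. by rewrite /enorm on eqxx sqrtr1. Qed.

Lemma dot_sum_basis u : dot u u = \sum_i dot u (e i) ^+ 2.
Proof. by rewrite {1 2}(basis_expansion u) dot_basis2; apply: eq_bigr. Qed.

Variables (A : 'M[R]_m) (l : 'I_m -> R).
Hypothesis Ae : forall i, A *m e i = l i *: e i.

Lemma mulmx_basis c : A *m (\sum_i c i *: e i) = \sum_i (l i * c i) *: e i.
Proof.
rewrite mulmx_sumr; apply: eq_bigr => i _.
by rewrite -scalemxAr Ae scalerA mulrC.
Qed.

Lemma eigvec_coord u a i : A *m u = a *: u -> dot u (e i) != 0 -> a = l i.
Proof.
move=> Au ui; have := congr1 (fun v => dot v (e i)) Au => /=.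
by rewrite {1}(basis_expansion u) mulmx_basis dot_basis dotZl => /(mulIf ui).
Qed.

Lemma eigval_basis i : is_eigval A (l i).
Proof.
exists (e i); split => //; apply: contra_eq_neq (enorm_basis i) => ->.
by rewrite enorm0 eq_sym oner_eq0.
Qed.

Lemma eigvalP a : is_eigval A a -> exists i, a = l i.
Proof.
move=> [u [u0 Au]].
have [i ui] : exists i, dot u (e i) != 0.
  apply: contrapT => /forallNP h; move/eqP: u0; apply.
  rewrite (basis_expansion u) big1// => i _.
  by have /negP := h i; rewrite negbK => /eqP ->; rewrite scale0r.
by exists i; exact: eigvec_coord ui.
Qed.

Lemma minsp_le i : minsp A <= `|l i|.
Proof.
apply: ge_inf; first by exists 0 => _ [a _ <-].
by exists (l i) => //; exact: eigval_basis.
Qed.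

Lemma le_minsp a : (0 < m)%N -> (forall i, a <= `|l i|) -> a <= minsp A.
Proof.
move=> m0 h; apply: lb_le_inf.
  by exists `|l (Ordinal m0)|, (l (Ordinal m0)) => //; exact: eigval_basis.
by move=> _ [b /eigvalP[i ->] <-].
Qed.

(** As [orth_proj] is a choice, its value is found through uniqueness: the difference of two
    candidates is orthogonal to the span of [S], hence to both candidates and to itself. *)
Lemma orth_proj_eq (S : set 'cV[R]_m) v p : in_span S p ->
  (forall u, S u -> dot (v - p) u = 0) -> orth_proj S v = p.
Proof.
move=> Sp vp; apply: xget_unique => // q [Sq vq].
apply/eqP; rewrite -subr_eq0; apply/eqP; apply: dot_eq0.
have orth r : in_span S r -> dot (q - p) r = 0.
  move=> [n [c [s [Ss ->]]]]; rewrite dotC dot_suml big1// => j _.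
  rewrite dotZl dotC (_ : q - p = (v - p) - (v - q)); last first.
    by rewrite opprB [RHS]addrC addrA subrK.
  by rewrite dotBl vp// vq// subrr mulr0.
by rewrite dotBr !orth ?subrr.
Qed.

Lemma pr_pos_basis c : pr_pos A (\sum_i c i *: e i) =
  \sum_i (if 0 < l i then c i else 0) *: e i.
Proof.
apply: orth_proj_eq.
  (* The zero vector fills the remaining slots; it belongs to [eigvecs_pos A], with eigenvalue 1. *)
  exists m, c, (fun i => if 0 < l i then e i else 0); split=> [i|].
    case: ifP => li; first by exists (l i).
    by exists 1; rewrite mulmx0 scaler0.
  by apply: eq_bigr => i _; case: ifP; rewrite // scale0r scaler0.
move=> u [a [a0 Au]].
rewrite -sumrB; under eq_bigr do rewrite -scalerBl.
rewrite (basis_expansion u) dot_basis2 big1// => i _.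
have [->|ui] := eqVneq (dot u (e i)) 0; first by rewrite mulr0.
by rewrite -(eigvec_coord _ _ _ Au ui) a0 subrr mul0r.
Qed.

Lemma mulmx_inv_basis c : (forall i, l i != 0) ->
  invmx A *m (\sum_i c i *: e i) = \sum_i ((l i)^-1 * c i) *: e i.
Proof.
(* The coordinates of a kernel vector of [A] vanish because each [l i] is nonzero; transposing turns
   this into freeness of the rows of [A^T]. *)
move=> l0; have Aunit : A \in unitmx.
  rewrite -unitmx_tr -row_free_unit; apply: inj_row_free => v vA.
  apply: trmx_inj; rewrite (basis_expansion v^T) trmx0 big1// => i _.
  have := congr1 (fun u : 'rV[R]_m => dot u^T (e i)) vA => /=.
  rewrite trmx_mul trmxK trmx0 {1}(basis_expansion v^T) mulmx_basis dot_basis.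
  rewrite dot0l => /eqP; rewrite mulf_eq0 (negPf (l0 i)) /= => /eqP ->.
  by rewrite scale0r.
rewrite -[RHS](mulKmx Aunit); congr (_ *m _); rewrite mulmx_basis.
by apply: eq_bigr => i _; rewrite mulrA divff// mul1r.
Qed.

End Eigenbasis.

(** Negative eigenvalues of [A] are positive ones of [- A], with the same eigenvectors, so
    [pr_pos_basis] applies to [- A] and [- l]. *)
Lemma pr_neg_basis {R : realType} {m : nat} (e : 'I_m -> 'cV[R]_m)
    (A : 'M[R]_m) (l c : 'I_m -> R) :
  (forall i j, dot (e i) (e j) = (i == j)%:R) ->
  (forall i, A *m e i = l i *: e i) ->
  pr_neg A (\sum_i c i *: e i) = \sum_i (if l i < 0 then c i else 0) *: e i.
Proof.
move=> on Ae; have NAe i : - A *m e i = - l i *: e i.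
  by rewrite mulNmx Ae scaleNr.
transitivity (pr_pos (- A) (\sum_i c i *: e i)).
  rewrite /pr_neg /pr_pos; congr orth_proj; apply/seteqP; split=> u [a [a0 Au]].
    by exists (- a); rewrite oppr_gt0 mulNmx Au scaleNr.
  exists (- a); rewrite oppr_lt0; split=> //; apply: oppr_inj.
  by rewrite scaleNr opprK -mulNmx.
rewrite (pr_pos_basis _ on _ _ NAe); apply: eq_bigr => i _.
by rewrite oppr_gt0.
Qed.

(** * Spectral bounds for the search direction *)

Section Direction.
Context {R : realType} {m : nat}.
Variables (delta : 'I_m.+1 -> R) (tau : R) (f : 'cV[R]_m -> R).
Hypothesis delta_inj : injective delta.

Lemma kappa_le i j : i != j -> kappa delta * 2 <= `|delta i - delta j|.
Proof.
move=> ij; rewrite /kappa divfK ?pnatr_eq0//; apply: ge_inf.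
  by exists 0 => _ [k _ <-].
by exists (i, j).
Qed.

Lemma kappa_gt0 : (0 < m)%N -> 0 < kappa delta.
Proof.
move=> m0; rewrite divr_gt0//.
have ne : [set `|delta ij.1 - delta ij.2| | ij in
    [set ij : 'I_m.+1 * 'I_m.+1 | ij.1 != ij.2]] !=set0.
  exists `|delta ord0 - delta ord_max|, (ord0, ord_max) => //=.
  by rewrite -val_eqE /= eq_sym -lt0n.
(* A minimum of finitely many positive numbers (and of the default 1) is a positive lower bound for
   the set under the infimum. *)
pose b : R := \big[Num.min/1]_(ij : 'I_m.+1 * 'I_m.+1 | ij.1 != ij.2)
  `|delta ij.1 - delta ij.2|.
apply: (@lt_le_trans _ _ b).
  apply/bigmin_gtP; split=> // -[i j] /= ij.
  by rewrite normr_gt0 subr_eq0 (inj_eq delta_inj).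
apply: lb_le_inf => // _ [ij /= ijn <-].
exact: bigmin_le_cond.
Qed.

Variables (x : 'cV[R]_m) (e : 'I_m -> 'cV[R]_m) (l : 'I_m -> R).
Hypothesis grad0 : grad f x != 0.
Hypothesis on : forall i j, dot (e i) (e j) = (i == j)%:R.
Hypothesis Ae : forall i, Amat delta tau f x *m e i = l i *: e i.
Local Notation g := (grad f x).
Local Notation w := (wdir delta tau f x).

Lemma grad_neq0_dim : (0 < m)%N.
Proof.
rewrite lt0n; apply: contraNneq grad0 => m0; apply/eqP/matrixP => -[i im] j.
by exfalso; move: im; rewrite m0.
Qed.

Lemma gpow_gt0 : 0 < gpow tau f x.
Proof. by apply: powR_gt0; exact: enorm_gt0. Qed.

(* Pigeonhole: an eigenvalue lies within kappa * gpow of at most one of the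
   m + 1 shifts, and there are only m eigenvalues. *)
Lemma exists_admissible : exists j, admissible delta tau f x j.
Proof.
apply: contrapT => /forallNP nadm.
(* Here [j0] may still be the default index. All shifts differ by multiples of the identity, so the
   eigenbasis of the shift [j0] diagonalises every shift [j], with eigenvalues [lj j i]. *)
pose j0 := jsel delta tau f x; pose s := gpow tau f x.
pose lj j i := l i + (delta j - delta j0) * s.
have lje j i : Ashift delta tau f x j *m e i = lj j i *: e i.
  rewrite (_ : Ashift _ _ _ _ _ = Amat delta tau f x + ((delta j - delta j0) * s)%:M).
    by rewrite mulmxDl Ae mul_scalar_mx -scalerDl.
  rewrite /Amat /Ashift -/j0 -/s -addrA !scalemx1 -raddfD /=; congr (_ + _%:M).
  by rewrite mulrBl addrC subrK.
have bad j : {i | `|lj j i| < kappa delta * s}.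
  apply: cid; apply: contrapT => /forallNP h; apply: (nadm j).
  apply: (le_minsp e on _ _ (lje j)) => [|i]; first exact: grad_neq0_dim.
  by rewrite leNgt; apply/negP; exact: h.
have /injectivePn[j [j' jj' ijj]] : ~~ injectiveb (fun j => sval (bad j)).
  apply/negP => /injectiveP /leq_card; by rewrite !card_ord ltnn.
have := svalP (bad j); have := svalP (bad j'); rewrite -ijj.
move: (sval _) => i h' h.
have := kappa_le _ _ jj'; rewrite leNgt => /negP; apply.
rewrite -(ltr_pM2r gpow_gt0) -[in ltLHS](gtr0_norm gpow_gt0) -normrM -/s.
rewrite (_ : _ * s = lj j i - lj j' i); last by rewrite /lj; ring.
by rewrite (le_lt_trans (ler_normB _ _))//; lra.
Qed.

Lemma jsel_admissible : admissible delta tau f x (jsel delta tau f x).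
Proof.
have [j jadm] := exists_admissible.
have [k [kadm kmin]] : exists k, admissible delta tau f x k /\
    forall j' : 'I_m.+1, (j' < k)%N -> ~~ admissible delta tau f x j'.
  have [k kadm kmin] := @arg_minnP _ j (admissible delta tau f x) val jadm.
  exists k; split=> // j' j'k; apply/negP => /kmin; rewrite leqNgt.
  by rewrite j'k.
by rewrite /jsel; case: xgetP => [i _ []|/(_ k) []].
Qed.

Lemma eigval_lb i : kappa delta * gpow tau f x <= `|l i|.
Proof. exact: le_trans jsel_admissible (minsp_le e on _ _ Ae i). Qed.

Lemma eigval_gt0 i : 0 < `|l i|.
Proof.
apply: lt_le_trans (eigval_lb i).
by rewrite mulr_gt0 ?gpow_gt0 ?kappa_gt0 ?grad_neq0_dim.
Qed.

(** Subtracting the negative part flips the sign of [(l i)^-1] exactly where [l i < 0]: [w] is the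
    inverse of the absolute value of the matrix [Amat], applied to the gradient. *)
Lemma wdir_basis : w = \sum_i (`|l i|^-1 * dot g (e i)) *: e i.
Proof.
have l0 i : l i != 0 by rewrite -normr_gt0 eigval_gt0.
rewrite /wdir /vdir {1 2}(basis_expansion e on g) (mulmx_inv_basis e on _ _ Ae)//.
rewrite (pr_pos_basis e on _ _ Ae) (pr_neg_basis e _ _ _ on Ae) -sumrB.
apply: eq_bigr => i _; rewrite -scalerBl; congr (_ *: _).
case: ltrgt0P => li; first by rewrite subr0.
  by rewrite sub0r invrN mulNr.
by move: (l0 i); rewrite li eqxx.
Qed.

Lemma dot_wdir : dot w g = \sum_i `|l i|^-1 * dot g (e i) ^+ 2.
Proof.
rewrite wdir_basis {2}(basis_expansion e on g) (dot_basis2 e on).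
by apply: eq_bigr => i _; rewrite expr2 mulrA.
Qed.

Lemma enorm_wdir : enorm w ^+ 2 = \sum_i `|l i|^-1 ^+ 2 * dot g (e i) ^+ 2.
Proof.
rewrite enorm_sqr wdir_basis (dot_basis2 e on).
by apply: eq_bigr => i _; rewrite -expr2 exprMn.
Qed.

(** Terms with [dot g (e i) = 0] drop out of the spectral sums, so here and in [enorm_wdir_ub]
    eigenvalue bounds are required only on the indices that the gradient sees. *)
Lemma dot_wdir_lb (b : R) : (forall i, dot g (e i) != 0 -> `|l i| <= b) ->
  0 < b -> enorm g ^+ 2 / b <= dot w g.
Proof.
move=> lb b0; rewrite dot_wdir enorm_sqr (dot_sum_basis e on) mulr_suml.
apply: ler_sum => i _; rewrite mulrC.
have [->|gi] := eqVneq (dot g (e i)) 0; first by rewrite expr0n !mulr0.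
by rewrite ler_wpM2r ?sqr_ge0// lef_pV2 ?posrE ?eigval_gt0// lb.
Qed.

Lemma enorm_wdir_ub (a : R) : (forall i, dot g (e i) != 0 -> a <= `|l i|) ->
  0 < a -> enorm w <= enorm g / a.
Proof.
move=> lb a0.
rewrite -(ler_pXn2r (n := 2)) ?nnegrE ?enorm_ge0 ?divr_ge0 ?enorm_ge0 ?(ltW a0)//.
rewrite enorm_wdir exprMn enorm_sqr (dot_sum_basis e on) mulr_suml.
apply: ler_sum => i _; rewrite [leRHS]mulrC.
have [->|gi] := eqVneq (dot g (e i)) 0; first by rewrite expr0n !mulr0.
rewrite ler_wpM2r ?sqr_ge0// ler_pXn2r ?nnegrE ?invr_ge0 ?(ltW a0)//.
by rewrite lef_pV2 ?posrE ?eigval_gt0// lb.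
Qed.

(** The quotient from the hypothesis of the theorem at a single iterate: the reciprocal condition
    number of [Amat] on the eigendirections that the gradient sees. *)
Definition eigratio : R :=
  let Lam := [set i | dot g (e i) != 0] in
  inf [set enorm (Amat delta tau f x *m e i) | i in Lam] /
  sup [set enorm (Amat delta tau f x *m e i) | i in Lam].

Lemma eigratio_bounds : exists a b : R, [/\ 0 < a, 0 < b, eigratio = a / b &
  forall i, dot g (e i) != 0 -> a <= `|l i| <= b].
Proof.
rewrite /eigratio.
pose S := [set `|l i| | i in [set i | dot g (e i) != 0]].
have -> : [set enorm (Amat delta tau f x *m e i) | i in
    [set i | dot g (e i) != 0]] = S.
  by apply: eq_imagel => i _; rewrite Ae enormZ (enorm_basis e on) mulr1.
have [i0 i0L] : exists i, dot g (e i) != 0.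
  apply: contrapT => /forallNP h; move/eqP: grad0; apply.
  rewrite (basis_expansion e on g) big1// => i _.
  by have /negP := h i; rewrite negbK => /eqP ->; rewrite scale0r.
have Si i : dot g (e i) != 0 -> S `|l i| by move=> gi; exists i.
have Slb : has_lbound S by exists 0 => _ [i _ <-].
have Sub : has_ubound S.
  exists (\sum_i `|l i|) => _ [i _ <-].
  by rewrite (bigD1 i)//= lerDl sumr_ge0.
have a0 : 0 < inf S.
  apply: (@lt_le_trans _ _ (kappa delta * gpow tau f x)).
    by rewrite mulr_gt0 ?gpow_gt0 ?kappa_gt0 ?grad_neq0_dim.
  apply: lb_le_inf; first by exists `|l i0|; exact: Si.
  by move=> _ [i _ <-]; exact: eigval_lb.
have ab i : dot g (e i) != 0 -> inf S <= `|l i| <= sup S.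
  by move=> gi; rewrite ge_inf ?ub_le_sup//; exact: Si.
exists (inf S), (sup S); split=> //.
by have /andP[h1 h2] := ab _ i0L; exact: lt_le_trans (lt_le_trans a0 h1) h2.
Qed.

Lemma eigratio_ge0 : 0 <= eigratio.
Proof.
by have [a [b [a0 b0 -> _]]] := eigratio_bounds; rewrite divr_ge0 ?ltW.
Qed.

(** With the relevant [|l i|] between [a] and [b], [dot w g] is at least [enorm g ^+ 2 / b] and
    [enorm w] at most [enorm g / a], so the cosine is at least [a / b]. *)
Lemma angle_wdir (c : R) : c <= eigratio -> c * (enorm w * enorm g) <= dot w g.
Proof.
have [a [b [a0 b0 -> ab]]] := eigratio_bounds; move=> cab.
have h1 : enorm g ^+ 2 / b <= dot w g.
  by apply: dot_wdir_lb => // i /ab /andP[].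
have h2 : enorm w <= enorm g / a.
  by apply: enorm_wdir_ub => // i /ab /andP[].
apply: le_trans h1.
apply: (@le_trans _ _ (a / b * (enorm g / a * enorm g))).
  apply: le_trans (_ : a / b * (enorm w * enorm g) <= _).
    by rewrite ler_wpM2r// mulr_ge0 ?enorm_ge0.
  by rewrite ler_wpM2l ?divr_ge0 ?(ltW a0) ?(ltW b0)// ler_wpM2r ?enorm_ge0.
rewrite le_eqVlt; apply/orP; left; apply/eqP.
by field; rewrite !gt_eqF.
Qed.

Lemma dot_wdir_gt0 : 0 < dot w g.
Proof.
have [a [b [a0 b0 _ ab]]] := eigratio_bounds.
apply: lt_le_trans (dot_wdir_lb b _ b0); last by move=> i /ab /andP[].
by rewrite divr_gt0// exprn_gt0// enorm_gt0.
Qed.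

Local Notation wh := (what delta tau f x).

Lemma max1_gt0 (a : R) : 0 < Num.max 1 a.
Proof. by rewrite lt_max ltr01. Qed.

Lemma enorm_what : enorm wh <= 1.
Proof.
rewrite /what enormZ normfV (gtr0_norm (max1_gt0 _)) mulrC.
by rewrite ler_pdivrMr ?max1_gt0// mul1r le_max lexx orbT.
Qed.

Lemma dot_what_gt0 : 0 < dot wh g.
Proof. by rewrite dotZl mulr_gt0 ?invr_gt0 ?max1_gt0 ?dot_wdir_gt0. Qed.

Lemma angle_what (c : R) : c <= eigratio -> c * (enorm wh * enorm g) <= dot wh g.
Proof.
move=> /angle_wdir h; rewrite dotZl enormZ normfV (gtr0_norm (max1_gt0 _)).
by rewrite -mulrA mulrCA ler_wpM2l// invr_ge0 ltW ?max1_gt0.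
Qed.

(** The two terms match the two cases of the normalisation: if [enorm w <= 1] then [wh = w] and the
    spectral bound applies; otherwise [wh] is a unit vector and the angle bound applies. *)
Lemma dot_what_lb (b c : R) : 0 <= c -> c <= eigratio -> 0 < b ->
  (forall i, `|l i| <= b) ->
  Num.min (enorm g ^+ 2 / b) (c * enorm g) <= dot wh g.
Proof.
move=> c0 cr b0 lb; rewrite ge_min dotZl.
have [w1|w1] := leP (enorm w) 1.
  by rewrite invr1 mul1r dot_wdir_lb.
apply/orP; right; rewrite [leRHS]mulrC ler_pdivlMr ?(lt_trans _ w1)//.
by rewrite -mulrA [enorm g * _]mulrC angle_wdir.
Qed.

End Direction.

(** * Calculus with continuous partial derivatives *)

Section Calculus.
Context {R : realType} {m : nat}.
Implicit Types (x y xs : 'cV[R]_m) (f : 'cV[R]_m -> R).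

Lemma nbhs_enormP x (U : set 'cV[R]_m) :
  nbhs x U <-> exists2 r, 0 < r & forall y, enorm (y - x) < r -> U y.
Proof.
split=> [/nbhs_normP[r /= r0 xrU]|[r r0 xrU]].
  exists r => // y yr; apply: xrU => /=.
  by rewrite distrC (le_lt_trans (norm_le_enorm _)).
(* Dividing by [m.+1] keeps the radius meaningful in dimension 0. *)
apply/(@nbhs_normP R _ x U); exists (r / m.+1%:R) => /=; first by rewrite divr_gt0.
move=> y /= xy; apply: xrU.
rewrite (le_lt_trans (enorm_le_norm _))// distrC.
apply: (@le_lt_trans _ _ (m.+1%:R * `|x - y|)); last first.
  by rewrite mulrC -ltr_pdivlMr.
by rewrite ler_wpM2r// ler_nat.
Qed.

Lemma enorm_le_coord x (a : R) : (forall i, `|x i ord0| <= a) -> enorm x <= m%:R * a.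
Proof.
move=> h; apply: le_trans (enorm_le_sum x) _.
rewrite -[X in X%:R]card_ord mulr_natl -sumr_const.
exact: ler_sum.
Qed.

Lemma norm_ev (i : 'I_m) : `|ev R i| <= 1.
Proof.
apply: norm_le_coord => // j; rewrite mxE eqxx andbT.
by case: (_ == _); rewrite ?normr1 ?normr0.
Qed.

Lemma is_derive_line f x v (s : R) : derivable f (s *: v + x) v ->
  is_derive s 1 (fun t : R => f (t *: v + x)) ('D_v f (s *: v + x)).
Proof.
have E : (fun h : R => h^-1 *: (((fun t : R => f (t *: v + x)) \o shift s) (h *: 1)
      - f (s *: v + x))) =
    (fun h => h^-1 *: ((f \o shift (s *: v + x)) (h *: v) - f (s *: v + x))).
  apply/funext => h /=; congr (_ *: (f _ - _)).
  by rewrite [h *: 1]mulr1 scalerDl addrA.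
by move=> df; apply: DeriveDef; rewrite /derivable /derive E.
Qed.

Lemma partial_mvt f i x (t : R) : (forall y, derivable f y (ev R i)) ->
  exists2 s : R, `|s| <= `|t| &
    f (t *: ev R i + x) - f x = t * partial i f (s *: ev R i + x).
Proof.
move=> df; pose F (s : R) := f (s *: ev R i + x).
have dF (s : R) : is_derive s 1 F (partial i f (s *: ev R i + x)).
  exact: is_derive_line.
have cF a b : {within `[a, b], continuous F}.
  by apply: derivable_within_continuous => s _; exact: ex_derive.
have F0 : f x = F 0 by rewrite /F scale0r add0r.
have [t0|/ltW t0] := leP 0 t.
  have [s] := @MVT_segment R F _ 0 t t0 (fun s _ => dF s) (cF 0 t).
  rewrite in_itv /= => /andP[s0 st] Fts; exists s.
    by rewrite !ger0_norm// (le_trans s0).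
  by rewrite F0 Fts subr0 mulrC.
have [s] := @MVT_segment R F _ t 0 t0 (fun s _ => dF s) (cF t 0).
rewrite in_itv /= => /andP[s0 st] Fts; exists s.
  by rewrite !ler0_norm// lerN2.
by rewrite F0 -opprB Fts sub0r mulrN opprK mulrC.
Qed.

Lemma Ck1P f : Ck 1 f -> (forall i y, derivable f y (ev R i)) /\
  (forall i, continuous (partial i f)).
Proof. by move=> [_ h]; split=> i; have [] := h i => // _ []. Qed.

Lemma Ck_weaken k f : Ck k.+1 f -> Ck k f.
Proof.
elim: k f => [|k IH] f [fc h]; split=> // i.
by have [h1 h2] := h i; split=> //; exact: IH.
Qed.

Lemma near_partials f x (eps : R) : (forall i, continuous (partial i f)) ->
  0 < eps -> \forall y \near x, forall i, `|partial i f y - partial i f x| < eps.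
Proof.
move=> cf e0; apply: (@filter_forall _ _
  (fun i => [set y | `|partial i f y - partial i f x| < eps]) (nbhs x)) => i.
by move: (cf i x) => /cvgrPdistC_lt; apply.
Qed.

Lemma near_grad f x (eps : R) : Ck 1 f -> 0 < eps ->
  \forall y \near x, enorm (grad f y - grad f x) < eps.
Proof.
move=> /Ck1P[_ cf] e0.
have e0' : 0 < eps / m.+1%:R by rewrite divr_gt0.
have := near_partials _ x _ cf e0'; apply: filterS => y h.
apply: (@le_lt_trans _ _ (m%:R * (eps / m.+1%:R))).
  by apply: enorm_le_coord => i; rewrite !mxE; exact/ltW/h.
by rewrite mulrA ltr_pdivrMr// mulrC ltr_pM2l// ltr_nat.
Qed.

(* Moving from x to y one coordinate at a time and applying the mean value
   theorem on each leg only involves partial derivatives near xs. *)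
Lemma strict_differentiability f xs (eps : R) : Ck 1 f -> 0 < eps ->
  exists2 r, 0 < r & forall x y, enorm (x - xs) < r -> enorm (y - xs) < r ->
    `|f y - f x - dot (grad f x) (y - x)| <= eps * enorm (y - x).
Proof.
(* Each of the [m] legs contributes at most [2 * d * enorm (y - x)], and [m * 2 * d <= eps]. *)
move=> /Ck1P[df cf] e0; pose d := eps / (2 * m.+1%:R).
have d0 : 0 < d by rewrite divr_gt0// mulr_gt0.
have /nbhs_normP[r /= r0 hr] := near_partials _ xs _ cf d0.
(* Points of a leg stay within [r] of [xs]: its start is within [r / 4], and the displacement along
   it is at most the distance from [x] to [y], below [r / 2]. *)
exists (r / 4); first by rewrite divr_gt0.
move=> x y xr yr; pose z (k : nat) : 'cV[R]_m :=
  \col_i (if (i < k)%N then y i ord0 else x i ord0).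
have z0 : z 0%N = x by apply/matrixP => i j; rewrite ord1 mxE ltn0.
have zm : z m = y by apply/matrixP => i j; rewrite ord1 mxE ltn_ord.
have zS (k : 'I_m) : z k.+1 = (y k ord0 - x k ord0) *: ev R k + z k.
  apply/matrixP => i j; rewrite ord1 !mxE eqxx andbT ltnS leq_eqVlt val_eqE.
  have [->|ik] := eqVneq i k; first by rewrite /= ltnn mulr1 subrK.
  by rewrite /= mulr0 add0r.
have zxs k : `|z k - xs| < r / 4.
  apply: (@le_lt_trans _ _ (Num.max `|y - xs| `|x - xs|)).
    apply: norm_le_coord => [|i]; first by rewrite le_max normr_ge0.
    rewrite !mxE le_max; case: ifP => _.
      by have := coord_le_norm (y - xs) i; rewrite !mxE => ->.
    by have := coord_le_norm (x - xs) i; rewrite !mxE => ->; rewrite orbT.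
  by rewrite gt_max !(le_lt_trans (norm_le_enorm _)).
have xxs : `|x - xs| < r / 4 by rewrite -z0.
have yxs : `|y - xs| < r / 4 by rewrite -zm.
have leg (k : 'I_m) : `|f (z k.+1) - f (z k) -
    partial k f x * (y k ord0 - x k ord0)| <= 2 * d * enorm (y - x).
  set h := y k ord0 - x k ord0; rewrite zS -/h.
  have hyx : h = (y - x) k ord0 by rewrite !mxE.
  have [s sh ->] := partial_mvt _ _ (z k) h (df k).
  rewrite (mulrC h) -mulrBl normrM; apply: ler_pM => //; last first.
    by rewrite hyx; exact: coord_le_enorm.
  have h1 : `|partial k f (s *: ev R k + z k) - partial k f xs| < d.
    apply: hr => /=; rewrite distrC -addrA.
    apply: le_lt_trans (ler_normD _ _) _; rewrite normrZ.
    have : `|s| * `|ev R k| <= `|s| by rewrite ler_piMr// norm_ev.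
    have : `|h| <= `|y - x| by rewrite hyx coord_le_norm.
    have : `|y - x| <= `|y - xs| + `|x - xs|.
      by rewrite (_ : y - x = y - xs - (x - xs)) ?ler_normB// opprB addrA subrK.
    move: (zxs k) xxs yxs sh; lra.
  have h2 : `|partial k f x - partial k f xs| < d.
    by apply: hr => /=; rewrite distrC; move: xxs; lra.
  rewrite (_ : partial k f (s *: ev R k + z k) - partial k f x =
    (partial k f (s *: ev R k + z k) - partial k f xs) -
    (partial k f x - partial k f xs)); last by rewrite opprB addrA subrK.
  by apply: le_trans (ler_normB _ _) _; move: h1 h2; lra.
have -> : f y - f x - dot (grad f x) (y - x) =
    \sum_(k < m) (f (z k.+1) - f (z k) - partial k f x * (y k ord0 - x k ord0)).
  rewrite sumrB; congr (_ - _); last by apply: eq_bigr => i _; rewrite !mxE.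
  by rewrite -(big_mkord xpredT (fun k => f (z k.+1) - f (z k))) telescope_sumr// zm z0.
apply: le_trans (ler_norm_sum _ _ _) _.
apply: (@le_trans _ _ (\sum_(k < m) (2 * d * enorm (y - x)))); first exact: ler_sum.
rewrite sumr_const card_ord -[leLHS]mulr_natl mulrA ler_wpM2r ?enorm_ge0//.
have -> : 2 * d = eps / m.+1%:R by rewrite /d invfM mulrCA mulVKf ?pnatr_eq0.
by rewrite mulrCA ler_piMr ?(ltW e0)// ler_pdivrMr// mul1r ler_nat.
Qed.

(** For a unit eigenvector, [|l|] is the length of [A *m u]. A bound through entries allows control
    of eigenvalues near a point without following them continuously. *)
Lemma eigval_le_entries (A : 'M[R]_m) (l : R) (u : 'cV[R]_m) :
  A *m u = l *: u -> enorm u = 1 -> `|l| <= \sum_i \sum_j `|A i j|.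
Proof.
move=> Au u1; have -> : `|l| = enorm (A *m u) by rewrite Au enormZ u1 mulr1.
apply: le_trans (enorm_le_sum _) _; apply: ler_sum => i _.
rewrite mxE; apply: le_trans (ler_norm_sum _ _ _) _; apply: ler_sum => j _.
by rewrite normrM ler_piMr// -u1 coord_le_enorm.
Qed.

(** The bound is uniform in [j] because the selected shift may jump as [x] varies. Near [xs] the
    Hessian entries and the gradient move by less than 1, which yields [B]. *)
Lemma near_Ashift_bounded (delta : 'I_m.+1 -> R) (tau : R) f xs :
  Ck 2 f -> 0 <= tau -> exists2 B : R, 0 < B & \forall x \near xs,
    forall j, \sum_i \sum_k `|Ashift delta tau f x j i k| <= B.
Proof.
move=> Cf tau0; have [_ C2] := Cf; have C1 := Ck_weaken _ _ Cf.
pose D := \sum_j `|delta j|; pose G := powR (enorm (grad f xs) + 1) tau.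
have D0 : 0 <= D by apply: sumr_ge0.
pose B := \sum_i \sum_k (`|hess f xs i k| + 1 + D * G).
exists (B + 1).
  rewrite ltr_wpDl//; do 2!apply: sumr_ge0 => ? _.
  by rewrite !addr_ge0// mulr_ge0// powR_ge0.
have hh : \forall x \near xs, forall i k, `|hess f x i k - hess f xs i k| < 1.
  apply: (@filter_forall _ _
    (fun i => [set x | forall k, `|hess f x i k - hess f xs i k| < 1]) (nbhs xs)) => i.
  have [_ /Ck1P[_ cp]] := C2 i.
  have := near_partials _ xs _ cp ltr01; apply: filterS => x h k.
  by rewrite !mxE; exact: h.
near=> x => j; rewrite (@le_trans _ _ B)//; last by rewrite lerDl.
do 2!apply: ler_sum => ? _; rewrite mxE.
apply: le_trans (ler_normD _ _) _; apply: lerD.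
  set i := (X in hess f x X); set k := (X in hess f x i X).
  have h : `|hess f x i k - hess f xs i k| < 1.
    by move: i k; near: x.
  have := lerB_dist (hess f x i k) (hess f xs i k); lra.
have gG : gpow tau f x <= G.
  apply: ge0_ler_powR; rewrite ?nnegrE ?addr_ge0 ?enorm_ge0//.
  have h : enorm (grad f x - grad f xs) < 1 by near: x; exact: near_grad.
  by have := enormD (grad f x - grad f xs) (grad f xs); rewrite subrK; lra.
rewrite !mxE normrM normrM (ger0_norm (powR_ge0 _ _)).
apply: (@le_trans _ _ (`|delta j| * gpow tau f x)).
  by rewrite ler_piMr ?mulr_ge0 ?powR_ge0//; case: (_ == _); rewrite ?normr1 ?normr0.
apply: ler_pM => //; first exact: powR_ge0.
by rewrite /D (bigD1 j)//= lerDl sumr_ge0.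
Unshelve. all: by end_near. Qed.

End Calculus.

(** * Backtracking line search *)

Section Armijo.
Context {R : realType} {m : nat}.
Variables (delta : 'I_m.+1 -> R) (tau gamma0 : R) (f : 'cV[R]_m -> R).

Lemma exists_small_step (r : R) : 0 < gamma0 < 1 -> 0 < r ->
  exists N, gamma0 / 3 ^+ N < r.
Proof.
move=> /andP[g0 g1] r0; exists (Num.Def.archi_bound r^-1).
set N := Num.Def.archi_bound _.
have h : r^-1 < 3 ^+ N.
  apply: lt_le_trans (upper_nthrootP (leqnn _)) _.
  by rewrite lerXn2r ?nnegrE// ler_nat.
rewrite ltr_pdivrMr ?exprn_gt0//; apply: (lt_trans g1).
by rewrite mulrC -ltr_pdivrMr// div1r.
Qed.

Lemma nselP x n : armijo delta tau gamma0 f x n ->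
  armijo delta tau gamma0 f x (nsel delta tau gamma0 f x) /\
  (nsel delta tau gamma0 f x <= n)%N.
Proof.
move=> hn; have [k hk kmin] := @ex_minnP _ (ex_intro _ n hn).
rewrite /nsel; case: xgetP => [i -> [hi imin]|/(_ k) []].
  by split=> //; rewrite leqNgt; apply/negP => /imin; rewrite hn.
by split=> // n' n'k; apply/negP => /kmin; rewrite leqNgt n'k.
Qed.

(** First-order expansion gives a decrease of at least [gam * (dot w g - eps)], where [g] is the
    gradient at [x]; with [eps] at most two thirds of [dot w g], the third demanded by Armijo
    remains. The ball is centred at [xs] so that one [n] can serve all nearby [x]. *)
Lemma armijo_near xs (r eps : R) x n :
  (forall x y, enorm (x - xs) < r -> enorm (y - xs) < r ->
    `|f y - f x - dot (grad f x) (y - x)| <= eps * enorm (y - x)) ->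
  0 < gamma0 -> gamma0 / 3 ^+ n < r / 2 -> enorm (x - xs) < r / 2 ->
  enorm (what delta tau f x) <= 1 -> 0 <= eps ->
  eps <= 2 / 3 * dot (what delta tau f x) (grad f x) ->
  armijo delta tau gamma0 f x n.
Proof.
move=> hf g0; rewrite /armijo; set gam := gamma0 / 3 ^+ n; set w := what _ _ _ _.
move=> gr xr w1 e0 ew; set y := x - gam *: w.
have gam0 : 0 < gam by rewrite divr_gt0 ?exprn_gt0.
have yx : y - x = - (gam *: w) by rewrite /y addrAC subrr add0r.
have nyx : enorm (y - x) <= gam.
  by rewrite yx enormN enormZ gtr0_norm// ler_piMr// ltW.
have yr : enorm (y - xs) < r.
  by apply: le_lt_trans (enormB_trans _ x _) _; lra.
have xr' : enorm (x - xs) < r by have := enorm_ge0 (x - xs); lra.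
have := hf x y xr' yr; rewrite {1}yx dotC dotNl dotZl => /ler_normlP[_].
have : eps * enorm (y - x) <= eps * gam by rewrite ler_wpM2l.
have : eps * gam <= 2 / 3 * dot w (grad f x) * gam by rewrite ler_wpM2r ?(ltW gam0).
lra.
Qed.

End Armijo.

(** Young's inequality for the conjugate exponents [mu^-1] and [(1 - mu)^-1]. *)
Lemma weighted_am_gm {R : realType} (p q mu : R) : 0 < p -> 0 < q -> 0 < mu < 1 ->
  powR p mu * powR q (1 - mu) <= mu * p + (1 - mu) * q.
Proof.
move=> p0 q0 /andP[mu0 mu1]; have nu0 : 0 < 1 - mu by rewrite subr_gt0.
apply: le_trans (@conjugate_powR R _ _ mu^-1 (1 - mu)^-1 _ _ _ _ _) _;
  rewrite ?powR_ge0 ?invr_gt0 ?invrK//; first by ring.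
by rewrite -!powRrM !divff ?gt_eqF// !powRr1 ?(ltW p0) ?(ltW q0)// [p * _]mulrC [q * _]mulrC.
Qed.

(** * Cluster points and convergence of descent sequences *)

Section ClusterPoint.
Context {R : realType} {m : nat}.
Variable x : nat -> 'cV[R]_m.

Definition cluster_point (xs : 'cV[R]_m) := forall (eps : R) (K : nat), 0 < eps ->
  exists2 k, (K <= k)%N & enorm (x k - xs) < eps.

Lemma exists_cluster_point : ~ ((fun k => enorm (x k)) @ \oo --> +oo) ->
  exists xs, cluster_point xs.
Proof.
move=> /cvgryPge/existsNP[M nM].
pose S := [set k | enorm (x k) < M].
have Sinf K : exists2 k, (K <= k)%N & S k.
  apply: contrapT => h; apply: nM; exists K => // k /= Kk.
  by rewrite leNgt; apply/negP => kM; apply: h; exists k.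
(* Restricting [\oo] to the infinite set [S] plays the role of a bounded subsequence; compactness of
   a box then gives a cluster point. The transposes [y k] fit [rV_compact], which concerns row
   vectors. *)
pose F := within S \oo.
have FF : ProperFilter F.
  apply: Build_ProperFilter_ex => A [K _ KA].
  by have [k Kk Sk] := Sinf K; exists k; exact: KA.
pose y k : 'rV[R]_m := (x k)^T.
have Fb : (y @ F) [set v : 'rV[R]_m | forall i, `[- M, M]%classic (v ord0 i)].
  rewrite /nbhs /= /within /=; exists 0%N => // k _ Sk i /=.
  rewrite in_itv /= -ler_norml mxE.
  exact: le_trans (coord_le_enorm _ _) (ltW Sk).
have [p [_ clp]] := @rV_compact R m (fun=> `[- M, M]%classic)
  (fun=> @segment_compact _ _ _) _ _ Fb.
exists p^T => eps K eps0.
have m0 : 0 < m.+1%:R :> R by [].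
have A1 : (y @ F) [set v | exists2 k, (K <= k)%N & v = y k].
  by rewrite /nbhs /= /within /=; exists K => // k /= Kk _; exists k.
have A2 : nbhs p [set v | `|p - v| < eps / m.+1%:R].
  apply/(@nbhs_normP R _ p (fun v => `|p - v| < eps / m.+1%:R)).
  by exists (eps / m.+1%:R) => //=; rewrite divr_gt0.
have [_ [[k Kk ->] /= pk]] := clp _ _ A1 A2.
exists k => //; apply: (@le_lt_trans _ _ (m%:R * `|p - y k|)).
  apply: enorm_le_coord => i; rewrite !mxE distrC.
  have := @coord_le_norm R m (p - y k)^T i; rewrite !mxE.
  move/le_trans; apply; rewrite [leLHS]/Num.norm /= mx_normrE.
  apply: bigmax_le => // -[a b] _ /=; rewrite mxE [leRHS]/Num.norm /= mx_normrE.
  by apply/bigmax_geP; right; exists (b, a).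
apply: (@le_lt_trans _ _ (m.+1%:R * `|p - y k|)).
  by rewrite ler_wpM2r// ler_nat.
by rewrite mulrC -ltr_pdivlMr.
Qed.

Variables (f : 'cV[R]_m -> R) (xs : 'cV[R]_m).
Hypothesis fc : continuous f.
Hypothesis fdec : forall k, f (x k.+1) < f (x k).
Hypothesis xsP : cluster_point xs.

Lemma near_value (eps : R) : 0 < eps ->
  exists2 r, 0 < r & forall y, enorm (y - xs) < r -> `|f y - f xs| < eps.
Proof. by move=> e0; apply/nbhs_enormP; move: (fc xs) => /cvgrPdistC_lt; apply. Qed.

Lemma descent_le k n : (k <= n)%N -> f (x n) <= f (x k).
Proof. by move/subnK <-; elim: (n - k)%N => // j; exact: le_trans (ltW (fdec _)). Qed.

(** Otherwise the next value is strictly below [f xs], and by monotonicity this gap persists,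
    contradicting continuity along iterates returning to [xs]. *)
Lemma cluster_value_lt k : f xs < f (x k).
Proof.
rewrite ltNge; apply/negP => fk.
have lt1 : f (x k.+1) < f xs by exact: lt_le_trans fk.
have e0 : 0 < f xs - f (x k.+1) by rewrite subr_gt0.
have [r r0 hr] := near_value _ e0.
have [n kn /hr] := xsP r k.+1 r0.
by have := descent_le _ _ kn; rewrite ltr_norml; lra.
Qed.

(* The powers (f (x k) - f xs) ^ (1 - mu) form a potential whose decrease
   dominates the length of the steps taken near xs. *)
Lemma lojasiewicz_convergence (c r : R) (K : nat) : 0 < c -> 0 < r ->
  (forall k, (K <= k)%N -> enorm (x k - xs) < r ->
    c * (enorm (x k.+1 - x k) * enorm (grad f (x k))) <= f (x k) - f (x k.+1)) ->
  loj_at f xs -> x @ \oo --> xs.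
Proof.
move=> c0 r0 angle [U [/nbhs_enormP[r1 r10 hU] [mu [C [mu01 [C0 loj]]]]]].
have /andP[mu0 mu1] := mu01; have nu0 : 0 < 1 - mu by rewrite subr_gt0.
pose F k := f (x k) - f xs; pose phi k := powR (F k) (1 - mu).
have F0 k : 0 < F k by rewrite subr_gt0 cluster_value_lt.
pose D := C / (c * (1 - mu)).
have D0 : 0 < D by rewrite divr_gt0 ?mulr_gt0.
have step k : (K <= k)%N -> enorm (x k - xs) < r -> enorm (x k - xs) < r1 ->
    enorm (x k.+1 - x k) <= D * (phi k - phi k.+1).
  move=> Kk kr /hU/loj; rewrite (gtr0_norm (F0 k)) -/(F k) => lojk.
  have ak := angle k Kk kr.
  have P0 : 0 < powR (F k) mu by rewrite powR_gt0.
  have E : powR (F k) mu * phi k = F k.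
    rewrite -powRD; last by rewrite (gt_eqF (F0 k)) implybT.
    by rewrite addrC subrK powRr1 ?(ltW (F0 k)).
  (* Together with [E] this is concavity of the power [1 - mu]: [powR (F k) mu * (phi k - phi k.+1)]
     is at least [(1 - mu) * (F k - F k.+1)]. *)
  have G := weighted_am_gm _ _ _ (F0 k) (F0 k.+1) mu01.
  rewrite -/(phi k.+1) in G.
  have FF : F k - F k.+1 = f (x k) - f (x k.+1) by rewrite /F; ring.
  rewrite /D mulrAC ler_pdivlMr ?mulr_gt0// -(ler_pM2l P0).
  apply: (@le_trans _ _ ((1 - mu) * (C * (F k - F k.+1)))).
    rewrite (_ : _ * (_ * _) = (1 - mu) * ((c * enorm (x k.+1 - x k)) * powR (F k) mu)); last by ring.
    rewrite ler_pM2l// FF; apply: le_trans (_ : C * (c * (enorm (x k.+1 - x k) *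
      enorm (grad f (x k)))) <= _); last by rewrite ler_pM2l.
    rewrite (_ : C * _ = (c * enorm (x k.+1 - x k)) * (C * enorm (grad f (x k)))); last by ring.
    by rewrite ler_wpM2l// mulr_ge0 ?enorm_ge0 ?(ltW c0).
  rewrite (_ : _ * (C * (phi k - _)) = C * (powR (F k) mu * phi k - powR (F k) mu * phi k.+1)); last by ring.
  rewrite E mulrCA ler_pM2l//; move: G; lra.
apply/cvgrPdistC_lt => eps eps0.
pose rho := Num.min eps (Num.min r r1).
have rho0 : 0 < rho by rewrite !lt_min eps0 r0.
have [rhoe rhor rhor1] : [/\ rho <= eps, rho <= r & rho <= r1].
  by rewrite !ge_min !lexx ?orbT.
have eta0 : 0 < rho / 2 / D by rewrite divr_gt0// divr_gt0.
(* The threshold makes [D * phi k0 < rho / 2]: half of [rho] is spent on the distance at [k0], half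
   on all later steps. *)
have [r2 r20 hr2] := near_value _ (powR_gt0 (1 - mu)^-1 eta0).
have s0 : 0 < Num.min (rho / 2) r2 by rewrite lt_min r20 divr_gt0.
have [k0 Kk0] := xsP _ K s0; rewrite lt_min => /andP[k0r /hr2].
rewrite (gtr0_norm (F0 k0)) -/(F k0) => Fk0.
have phik0 : D * phi k0 < rho / 2.
  rewrite mulrC -ltr_pdivlMr//.
  have := @gt0_ltr_powR R _ nu0 (F k0) _ _ _ Fk0; rewrite !nnegrE ltW//.
  by rewrite powR_ge0 -powRrM mulVf ?gt_eqF// powRr1 ?ltW//; apply.
have phi_ge0 k : 0 <= phi k by exact: powR_ge0.
(* The bound at [n] puts the iterate inside the ball where [step] is valid, which yields the bound
   at [n.+1]; so confinement and length estimate are proved together. *)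
have near_tail n : enorm (x (k0 + n)%N - xs) <=
    enorm (x k0 - xs) + D * (phi k0 - phi (k0 + n)%N).
  elim: n => [|n IH]; first by rewrite addn0 subrr mulr0 addr0.
  have lt_rho : enorm (x (k0 + n)%N - xs) < rho.
    apply: (le_lt_trans IH); have := mulr_ge0 (ltW D0) (phi_ge0 (k0 + n)%N); lra.
  have := step (k0 + n)%N (leq_trans Kk0 (leq_addr _ _))
    (lt_le_trans lt_rho rhor) (lt_le_trans lt_rho rhor1).
  have := enormB_trans (x (k0 + n.+1)%N) (x (k0 + n)%N) xs.
  rewrite addnS; lra.
exists k0 => // k /= /subnKC <-; apply: le_lt_trans (norm_le_enorm _) _.
apply: lt_le_trans rhoe; apply: le_lt_trans (near_tail _) _.
have := mulr_ge0 (ltW D0) (phi_ge0 (k0 + (k - k0))%N); lra.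
Qed.

End ClusterPoint.

(** * From lower limits along subsequences to a uniform bound *)

Lemma limn_inf_eq0 {R : realType} (u : nat -> R) :
  (forall n, 0 <= u n) -> u @ \oo --> (0 : R) -> limn_inf u = 0.
Proof.
move=> u0 ucv; rewrite /limn_inf (_ : infs u = fun=> 0) ?lim_cst//.
apply/funext => n; apply/eqP; rewrite eq_le; apply/andP; split; last first.
  by apply: lb_le_inf; [exists (u n), n => /=|move=> _ [k _ <-]].
apply/ler_addgt0Pl => eps eps0; rewrite addr0.
move/cvgrPdistC_lt: ucv => /(_ _ eps0)[K _ hK].
have := hK (maxn n K) (leq_maxr _ _); rewrite /= subr0 ger0_norm// => h.
apply: le_trans (ltW h); apply: ge_inf; first by exists 0 => _ [k _ <-].
by exists (maxn n K) => //=; exact: leq_maxl.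
Qed.

(** If no bound holds, arbitrarily late indices have [x k] within [n.+1%:R^-1] of [xs] and [u k]
    below it; chosen increasingly, they form a subsequence converging to [xs] whose lower limit is
    0. *)
Lemma uniform_lower_bound {R : realType} {m : nat} (u : nat -> R)
    (x : nat -> 'cV[R]_m) (xs : 'cV[R]_m) : (forall k, 0 <= u k) ->
  (forall kn : nat -> nat, {homo kn : a b / (a < b)%N} -> cvgn (x \o kn) ->
    0 < limn_inf (u \o kn)) ->
  exists (c r : R) (K : nat), [/\ 0 < c, 0 < r &
    forall k, (K <= k)%N -> enorm (x k - xs) < r -> c <= u k].
Proof.
move=> u0 hinf; apply: contrapT => H.
have bad (n K : nat) : {k | [/\ (K <= k)%N, enorm (x k - xs) < n.+1%:R^-1 &
    u k < n.+1%:R^-1]}.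
  apply: cid; apply: contrapT => /forallNP h; apply: H.
  exists n.+1%:R^-1, n.+1%:R^-1, K; split=> [||k Kk kr]; rewrite ?invr_gt0//.
  by rewrite leNgt; apply/negP => uk; exact: (h k).
pose kn := fix kn n := match n with
  | 0 => sval (bad 0%N 0%N) | n'.+1 => sval (bad n'.+1 (kn n').+1) end.
have knS n : (kn n < kn n.+1)%N by have [] := svalP (bad n.+1 (kn n).+1).
have knP n : enorm (x (kn n) - xs) < n.+1%:R^-1 /\ u (kn n) < n.+1%:R^-1.
  by case: n => [|n]; [have [] := svalP (bad 0%N 0%N) |
    have [] := svalP (bad n.+1 (kn n).+1)].
have small (eps : R) : 0 < eps -> \forall n \near \oo, (n.+1%:R^-1 : R) < eps.
  by move=> e0; exact: near_infty_natSinv_lt (PosNum e0).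
have xkn : x \o kn @ \oo --> xs.
  apply/cvgrPdistC_lt => eps /small; apply: filterS => n.
  exact/lt_trans/(le_lt_trans (norm_le_enorm _))/(knP n).1.
have ukn : u \o kn @ \oo --> (0 : R).
  apply/cvgrPdistC_lt => eps /small; apply: filterS => n /=.
  by rewrite subr0 ger0_norm//; apply/lt_trans/(knP n).2.
have := hinf kn (homo_ltn ltn_trans knS) (cvgP _ xkn).
by rewrite limn_inf_eq0 ?ltxx// => n; exact: u0.
Qed.

(** * Convergence of the iterates *)

Theorem theorem3 (R : realType) (m : nat) (delta : 'I_m.+1 -> R) (tau gamma0 : R)
  (f : 'cV[R]_m -> R) (x : nat -> 'cV[R]_m) (e : nat -> 'I_m -> 'cV[R]_m) :
  injective delta ->
  0 < tau <= 1 ->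
  0 < gamma0 < 1 ->
  Ck 3 f ->
  (forall xs, grad f xs = 0 -> loj_at f xs) ->
  (forall k, x k.+1 = bnqn_step delta tau gamma0 f (x k)) ->
  (* e k is an orthonormal basis of eigenvectors of A_k, when grad f (x k) <> 0 *)
  (forall k, grad f (x k) != 0 ->
     (forall i j, dot (e k i) (e k j) = (i == j)%:R) /\
     (forall i, exists l : R, Amat delta tau f (x k) *m e k i = l *: e k i)) ->
  (forall kn : nat -> nat, {homo kn : a b / (a < b)%N} ->
     (forall n, grad f (x (kn n)) != 0) ->
     cvgn (x \o kn) ->
     0 < limn_inf (fun n =>
       let k := kn n in
       let Lam := [set i | dot (grad f (x k)) (e k i) != 0] in
       inf [set enorm (Amat delta tau f (x k) *m e k i) | i in Lam] /
       sup [set enorm (Amat delta tau f (x k) *m e k i) | i in Lam])) ->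
  (tau = 1 -> forall z : 'cV[R]_(m + m), loj_at (gradF f) z) ->
  ((fun k => enorm (x k)) @ \oo --> +oo) \/
  (exists xs : 'cV[R]_m, grad f xs = 0 /\ x @ \oo --> xs).
Proof.
move=> dinj /andP[tau0 _] g01 C3 loj xS eig ratio _.
have /andP[gm0 _] := g01.
have C2 := Ck_weaken _ _ C3; have C1 := Ck_weaken _ _ C2; have [fc _] := C1.
(* Once a gradient vanishes the sequence is stationary; otherwise the eigenbases are available at
   every [k]. *)
have [[k0 gk0]|/forallNP gN] := pselect (exists k, grad f (x k) = 0).
  right; exists (x k0); split=> //; apply: (@cvg_near_cst _ _ _ _ _ _).
  exists k0 => // k /= /subnKC <-; elim: (k - k0)%N => [|n IH].
    by rewrite addn0.
  by rewrite addnS xS IH /bnqn_step gk0 eqxx.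
have g0 k : grad f (x k) != 0 by apply/eqP; exact: gN.
have on k i j : dot (e k i) (e k j) = (i == j)%:R by have [] := eig k (g0 k).
have [l Ae] : exists l : nat -> 'I_m -> R,
    forall k i, Amat delta tau f (x k) *m e k i = l k i *: e k i.
  have /choice[l hl] (k : nat) : exists l : 'I_m -> R,
      forall i, Amat delta tau f (x k) *m e k i = l i *: e k i.
    by have [_ /choice[l hl]] := eig k (g0 k); exists l.
  by exists l.
have [?|xNoo] := pselect ((fun k => enorm (x k)) @ \oo --> +oo); first by left.
right; have [xs xsP] := exists_cluster_point _ xNoo; exists xs.
pose wh k := what delta tau f (x k).
pose u k := eigratio delta tau f (x k) (e k).
have wh1 k : enorm (wh k) <= 1 by exact: enorm_what.
have whg k : 0 < dot (wh k) (grad f (x k)).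
  exact: (dot_what_gt0 _ _ _ dinj _ _ _ (g0 k) (on k) (Ae k)).
have xSE k : x k.+1 = x k - gammak delta tau gamma0 f (x k) *: wh k.
  by rewrite xS /bnqn_step (negPf (g0 k)).
(* Centring [armijo_near] at [x k] itself shows that the line search terminates, so [nsel] is an
   accepted exponent. *)
have arm k : armijo delta tau gamma0 f (x k) (nsel delta tau gamma0 f (x k)).
  have e0 : 0 < 2 / 3 * dot (wh k) (grad f (x k)) by rewrite mulr_gt0.
  have [r r0 hr] := strict_differentiability f (x k) _ C1 e0.
  have r20 : 0 < r / 2 by rewrite divr_gt0.
  have [N hN] := exists_small_step gamma0 _ g01 r20.
  have aN : armijo delta tau gamma0 f (x k) N.
    apply: (armijo_near _ _ _ _ _ _ _ _ _ hr) => //;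
      [by rewrite subrr enorm0|exact: wh1|exact: ltW].
  by have [] := nselP _ _ _ _ _ _ aN.
have gam0 k : 0 < gammak delta tau gamma0 f (x k).
  by rewrite divr_gt0 ?exprn_gt0.
have desc k : gammak delta tau gamma0 f (x k) * dot (wh k) (grad f (x k)) / 3 <=
    f (x k) - f (x k.+1).
  by have := arm k; rewrite /armijo -/(gammak _ _ _ _ _) -/(wh k) -xSE; lra.
have fdec k : f (x k.+1) < f (x k).
  rewrite -subr_gt0; apply: lt_le_trans (desc k).
  by rewrite divr_gt0 ?mulr_gt0.
have [c [r [K [c0 r0 hc]]]] : exists (c r : R) (K : nat), [/\ 0 < c, 0 < r &
    forall k, (K <= k)%N -> enorm (x k - xs) < r -> c <= u k].
  apply: uniform_lower_bound => [k|kn kn_inc xkn].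
    exact: (eigratio_ge0 _ _ _ dinj _ _ _ (g0 k) (on k) (Ae k)).
  exact: (ratio kn kn_inc (fun n => g0 _) xkn).
have crit : grad f xs = 0.
  apply/eqP; apply: contrapT => /negP gxs.
  pose a := enorm (grad f xs) / 2.
  have a0 : 0 < a by rewrite divr_gt0 ?enorm_gt0.
  have [B B0 /nbhs_enormP[r1 r10 hB]] :=
    near_Ashift_bounded delta tau f xs C2 (ltW tau0).
  have /nbhs_enormP[r2 r20 hg] := near_grad f xs a C1 a0.
  (* Near [xs] the gradient has length at least [a] and the eigenvalues are at most [B] in absolute
     value, so [dot_what_lb] gives [eta] as a lower bound for the slope along [wh]. *)
  pose eta := Num.min (a ^+ 2 / B) (c * a).
  have eta0 : 0 < eta.
    rewrite lt_min; apply/andP; split; last exact: mulr_gt0.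
    by apply: divr_gt0; first exact: exprn_gt0.
  have eta1 : 0 < 2 / 3 * eta by rewrite mulr_gt0.
  have [r3 r30 hr3] := strict_differentiability f xs _ C1 eta1.
  have r32 : 0 < r3 / 2 by rewrite divr_gt0.
  have [N hN] := exists_small_step gamma0 _ g01 r32.
  (* The decrease guaranteed by Armijo's rule for slope at least [eta] and any step at least
     [gamma0 / 3 ^+ N]. *)
  pose d := gamma0 / 3 ^+ N * eta / 3.
  have d0 : 0 < d.
    apply: divr_gt0; last by [].
    by apply: mulr_gt0 eta0; apply: divr_gt0; rewrite ?exprn_gt0.
  have [r4 r40 hr4] := near_value f xs fc _ d0.
  pose rho := Num.min (Num.min r r1) (Num.min r2 (Num.min (r3 / 2) r4)).
  have rho0 : 0 < rho by rewrite !lt_min r0 r10 r20 r32 r40.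
  have [k Kk] := xsP _ K rho0.
  rewrite !lt_min => /andP[/andP[kr kr1] /and3P[kr2 kr3 kr4]].
  have ga : a <= enorm (grad f (x k)).
    have := hg _ kr2; have := enormB_trans (grad f xs) (grad f (x k)) 0.
    by rewrite !subr0 enormBC /a; lra.
  have wg : eta <= dot (wh k) (grad f (x k)).
    apply: le_trans (dot_what_lb _ _ _ dinj _ _ _ (g0 k) (on k) (Ae k) B c
      (ltW c0) (hc k Kk kr) B0 _); last first.
      move=> i; apply: le_trans (eigval_le_entries _ _ _ (Ae k i) _) (hB _ kr1 _).
      exact: enorm_basis (on k) i.
    rewrite le_min !ge_min; apply/andP; split; apply/orP; [left|right].
      by rewrite ler_wpM2r ?invr_ge0 ?(ltW B0)// lerXn2r ?nnegrE ?enorm_ge0 ?(ltW a0).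
    by rewrite ler_pM2l.
  have aN : armijo delta tau gamma0 f (x k) N.
    apply: (armijo_near _ _ _ _ _ _ _ _ _ hr3) => //;
      [exact: wh1|exact: ltW|by rewrite ler_pM2l].
  have [_ nN] := nselP _ _ _ _ _ _ aN.
  have dk : d <= f (x k) - f (x k.+1).
    apply: le_trans (desc k); rewrite /d ler_pM2r ?invr_gt0//.
    apply: ler_pM => //; [by rewrite ltW ?divr_gt0 ?exprn_gt0|exact: ltW|].
    by rewrite ler_pM2l// lef_pV2 ?posrE ?exprn_gt0// ler_weXn2l// ler1n.
  (* Since [f (x k) < f xs + d], a drop by [d] puts [f (x k.+1)] below [f xs], which all values
     exceed. *)
  have := cluster_value_lt _ _ _ fc fdec xsP k.+1.
  by have := hr4 _ kr4; rewrite ltr_norml; lra.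
split=> //.
(* The constant combines the cosine bound [c] with the factor 1/3 of Armijo's rule. *)
apply: (lojasiewicz_convergence _ _ _ fc fdec xsP (c / 3) r K) => //; last exact: loj.
  by rewrite divr_gt0.
move=> k Kk kr; apply: le_trans (desc k).
have an := angle_what _ _ _ dinj _ _ _ (g0 k) (on k) (Ae k) _ (hc k Kk kr).
rewrite xSE addrAC subrr add0r enormN enormZ gtr0_norm//.
have := ler_wpM2l (ltW (gam0 k)) an; rewrite -/(wh k); lra.
Qed.
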